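(* Let $\delta$ be a real number with $0 < \delta < 1$, and suppose there exists a positive integer $M$ such that for every integer $m > M$ the consecutive primes $p_m, p_{m+1}$ satisfy $\sqrt[3]{p_{m+1}} - \sqrt[3]{p_m} < 1 - \delta$. Then for every integer $n > p_M$ there is a prime number $p$ with $n^3 < p < (n+1)^3$.
   Context: $p_1 = 2 < p_2 = 3 < p_3 < \cdots$ denotes the increasing enumeration of all prime numbers, so $p_m$ is the $m$-th prime. *)

(* Defs.v *)
From mathcomp Require Import all_boot.

Lemma next_prime_subproof (n : nat) : exists q, (n < q) && prime q.
Proof. by have [q lt_nq pr_q] := prime_above n; exists q; rewrite lt_nq. Qed.

Definition next_prime (n : nat) : nat := ex_minn (next_prime_subproof n).

(* The index starts at 1: nth_prime 1 = 2, nth_prime 2 = 3, ...  The value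
   nth_prime 0 = 0 is not a prime and only seeds the recursion. *)
Fixpoint nth_prime (m : nat) : nat :=
  if m is m'.+1 then next_prime (nth_prime m') else 0.

Lemma nth_prime_prime (m : nat) : 0 < m -> prime (nth_prime m).
Proof.
by case: m => // m _ /=; rewrite /next_prime; case: ex_minnP => q /andP[].
Qed.

Lemma nth_prime_ltS (m : nat) : nth_prime m < nth_prime m.+1.
Proof. by rewrite /= /next_prime; case: ex_minnP => q /andP[]. Qed.

Lemma nth_prime_surj (q : nat) :
  prime q -> exists2 m, 0 < m & nth_prime m = q.
Proof.
move=> pr_q; have lt_id m : m <= nth_prime m.
  by elim: m => // m IH; apply: leq_ltn_trans IH (nth_prime_ltS m).
have [m le_qm min_m] := ex_minnP (ex_intro (fun m => q <= nth_prime m) q (lt_id q)).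
case: m le_qm min_m => [|m] le_qm min_m.
  by move: le_qm; rewrite leqNgt prime_gt0.
exists m.+1 => //; apply/eqP; rewrite eqn_leq le_qm andbT /= /next_prime.
case: ex_minnP => r _; apply; rewrite pr_q andbT ltnNge.
by apply/negP => /min_m; rewrite ltnn.
Qed.

Lemma nth_prime1 : nth_prime 1 = 2.
Proof.
rewrite /= /next_prime; case: ex_minnP => q /andP[_ pr_q] min_q.
by apply/eqP; rewrite eqn_leq prime_gt1 // min_q.
Qed.

(* Main.v *)
Require Import Defs.
From mathcomp Require Import all_boot all_order all_algebra.
From mathcomp Require Import zify.
From mathcomp Require Import reals exp.

(** Let [r] be the least prime above [n ^ 3] and [p] its predecessor among the
    primes.  If the gap hypothesis applies to [p], then the cube root of [r] is
    less than [n + 1 - delta], so [r < (n + 1) ^ 3].  It applies as soon as some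
    prime lies in the interval from [nth_prime M + 1] to [n ^ 3]; for this a weak
    form of Bertrand's postulate suffices, namely a prime in [[n, 2 n ^ 2]].
    Chebyshev's argument gives it: every prime power dividing ['C(2 N, N)]
    exactly is at most [2 N], so if all primes up to [2 N] were below [n], then
    [2 ^ N <= 'C(2 N, N) <= (2 N) ^ (n - 1)], which fails for [N = n ^ 2]. *)

Import Order.TTheory GRing.Theory Num.Theory.

(** Terms of Legendre's sum past [n] vanish. A common range lets the sums for the three factorials
    in a binomial coefficient be compared termwise. *)
Lemma logn_fact_widen (p n m : nat) : prime p -> n < m ->
  logn p n`! = \sum_(1 <= k < m) n %/ p ^ k.
Proof.
move=> pr_p lt_nm; rewrite logn_fact // [RHS](big_cat_nat _ (n := n.+1)) //=.
rewrite -[LHS]addn0; congr (_ + _); rewrite big_nat_cond big1 // => k.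
case/andP=> /andP[lt_nk _] _.
by rewrite divn_small // (ltn_trans lt_nk) // ltn_expl // prime_gt1.
Qed.

(** Kummer's idea: the exponent counts the [k] for which adding [m] and [n - m] in base [p] carries
    into position [k], and a carry forces [p ^ k <= n]. *)
Lemma logn_bin_le (p n m : nat) : prime p -> m <= n ->
  logn p 'C(n, m) <= trunc_log p n.
Proof.
move=> pr_p le_mn; have p_gt1 := prime_gt1 pr_p.
have := congr1 (logn p) (bin_fact le_mn).
rewrite !lognM ?muln_gt0 ?fact_gt0 ?bin_gt0 //.
rewrite !(@logn_fact_widen p _ n.+1) ?ltnS ?leq_subr //.
rewrite -big_split /= => def_n.
rewrite -(leq_add2r (\sum_(1 <= k < n.+1) (m %/ p ^ k + (n - m) %/ p ^ k))).
rewrite {}def_n.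
have le_count : \sum_(1 <= k < n.+1) (k <= trunc_log p n) <= trunc_log p n.
  elim: {1}n => [|j IH]; first by rewrite big_geq.
  rewrite big_nat_recr //=; case: (leqP j.+1) => [le_j|_]; last by rewrite addn0.
  rewrite addn1 (leq_trans _ le_j) // ltnS big_nat_cond.
  apply: leq_trans (_ : \sum_(1 <= k < j.+1) 1 <= j); last first.
    by rewrite sum_nat_const_nat muln1 subn1.
  by rewrite [leqRHS]big_nat_cond leq_sum // => k _; apply: leq_b1.
apply: leq_trans (leq_add le_count (leqnn _)); rewrite -big_split /=.
(* [divnD] isolates the carry as a boolean: it is 1 when the residues of [m] and [n - m] sum to at
   least [p ^ k]. *)
apply: leq_sum => k _; rewrite -{1}(subnKC le_mn) divnD ?expn_gt0 ?prime_gt0 //.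
rewrite addnC leq_add2r; case: (leqP (p ^ k)) => //= le_pk.
rewrite lt0b; apply: trunc_log_max => //; apply: leq_trans le_pk _.
by rewrite -{2}(subnKC le_mn) leq_add // leq_mod.
Qed.

(** Pascal's rule splits the next central coefficient into two terms, each at least the current
    one. *)
Lemma exp2_le_central_bin (n : nat) : 2 ^ n <= 'C(n.*2, n).
Proof.
elim: n => // n IH; rewrite doubleS binS expnS mul2n -addnn.
apply: leq_add; last exact: leq_trans IH (leq_bin2l _ (leqnSn _)).
by rewrite binS (leq_trans IH) // leq_addl.
Qed.

Lemma bin_le_exp_primes (n m : nat) : m <= n ->
  'C(n, m) <= n ^ size (primes 'C(n, m)).
Proof.
case: (posnP n) => [-> | n_gt0 le_mn]; first by rewrite leqn0 => /eqP->.
have C_gt0 : 0 < 'C(n, m) by rewrite bin_gt0.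
rewrite {1}(prod_prime_decomp C_gt0) prime_decompE big_map /=.
have: all prime (primes 'C(n, m)).
  by apply/allP => p; rewrite mem_primes => /andP[].
elim: (primes _) => [|p s IH] /=; first by rewrite big_nil.
case/andP=> pr_p pr_s; rewrite big_cons expnS leq_mul ?IH //.
have p_gt1 := prime_gt1 pr_p.
apply: leq_trans (trunc_logP p_gt1 n_gt0).
by rewrite leq_exp2l // logn_bin_le.
Qed.

Lemma sqr_le_exp2 (n : nat) : 3 < n -> n ^ 2 <= 2 ^ n.
Proof.
elim: n => // n IH; rewrite ltnS leq_eqVlt => /orP[/eqP<- //|/[dup] lt3n /IH].
move=> {}IH; apply: (@leq_trans (2 * n ^ 2)); first by rewrite -!mulnn; nia.
by rewrite [leqRHS]expnS leq_mul2l IH.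
Qed.

Lemma prime_le_double_sqr (n : nat) : 2 < n ->
  exists2 p, prime p & n <= p <= (n ^ 2).*2.
Proof.
move=> n_gt2; set N := n ^ 2.
have le_N2 : N <= N.*2 by rewrite -addnn leq_addr.
have [/hasP[p p_C le_np]|no_p] := boolP (has (leq n) (primes 'C(N.*2, N))).
  move: p_C; rewrite mem_primes => /and3P[pr_p C_gt0 dvd_p]; exists p => //.
  have := leq_trans (_ : 0 < _) (logn_bin_le p _ N pr_p le_N2).
  rewrite logn_gt0 mem_primes pr_p C_gt0 dvd_p trunc_log_gt0 => /(_ isT).
  by rewrite le_np; case: p {dvd_p le_np} pr_p => // p _ /andP[].
have le_size : size (primes 'C(N.*2, N)) <= n.-1.
  rewrite -(size_iota 1 n.-1); apply: uniq_leq_size (primes_uniq _) _ => p p_C.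
  move/hasPn: no_p => /(_ p p_C); rewrite -ltnNge mem_iota add1n prednK //.
    by move: p_C; rewrite mem_primes => /andP[/prime_gt0->].
  exact: ltn_trans n_gt2.
have := leq_trans (exp2_le_central_bin N) (bin_le_exp_primes _ _ le_N2).
have N2_gt0 : 0 < N.*2 by rewrite double_gt0 expn_gt0 (ltn_trans _ n_gt2).
rewrite leqNgt => /negP[]; apply: leq_ltn_trans (leq_pexp2l N2_gt0 le_size) _.
rewrite /N {N le_N2 N2_gt0 no_p le_size}.
(* The case [n = 3] is computed, since [n ^ 2 <= 2 ^ n] fails there. Beyond it, the base is at most
   [2 ^ n.+1], and [(n + 1) (n - 1) < n ^ 2]. *)
move: n_gt2; rewrite leq_eqVlt => /orP[/eqP<- //|lt3n].
have le_2n : (n ^ 2).*2 <= 2 ^ n.+1.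
  by rewrite [leqRHS]expnS mul2n leq_double sqr_le_exp2.
apply: (@leq_ltn_trans ((2 ^ n.+1) ^ n.-1)).
  by rewrite leq_exp2r //; lia.
rewrite -expnM ltn_exp2l //; nia.
Qed.

Lemma nth_prime_lt_mono (m n : nat) : (nth_prime m < nth_prime n) = (m < n).
Proof.
have lt_homo : {homo nth_prime : i j / i < j}.
  exact: homo_ltn ltn_trans nth_prime_ltS.
exact: (leqW_mono (leq_mono lt_homo)).
Qed.

Lemma next_primeP (n : nat) :
  [/\ prime (next_prime n), n < next_prime n
    & forall q, prime q -> n < q -> next_prime n <= q].
Proof.
rewrite /next_prime; case: ex_minnP => r /andP[lt_nr pr_r] min_r.
by split=> // q pr_q lt_nq; rewrite min_r // lt_nq.
Qed.

Local Open Scope ring_scope.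

Lemma cube_root_exp3 (R : realType) (x : R) : 0 <= x -> (x `^ 3^-1) ^+ 3 = x.
Proof.
move=> x_ge0; rewrite -powR_mulrn ?powR_ge0 // -powRrM mulVf ?pnatr_eq0 //.
by rewrite powRr1.
Qed.

Theorem theorem6 (R : realType) (delta : R) (M : nat) :
  0 < delta < 1 ->
  (0 < M)%N ->
  (forall m : nat, (M < m)%N ->
    (nth_prime m.+1)%:R `^ 3^-1 - (nth_prime m)%:R `^ 3^-1 < 1 - delta) ->
  forall n : nat, (nth_prime M < n)%N ->
    exists2 p : nat, prime p & (n ^ 3 < p < n.+1 ^ 3)%N.
Proof.
move=> /andP[delta_gt0 _] M_gt0 gap n lt_Mn.
have n_gt2 : (2 < n)%N.
  exact: leq_ltn_trans (prime_gt1 (nth_prime_prime _ M_gt0)) lt_Mn.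
have [pr_r lt_nr min_r] := next_primeP (n ^ 3).
have [[|m] // _ def_r] := nth_prime_surj _ pr_r.
have le_mn : (nth_prime m <= n ^ 3)%N.
  (* For [m = 0] the seed value 0 makes the bound trivial. *)
  case: (posnP m) => [-> //|m_gt0]; rewrite leqNgt; apply/negP => lt_nm.
  have := min_r _ (nth_prime_prime _ m_gt0) lt_nm.
  by rewrite -def_r leqNgt nth_prime_ltS.
have lt_Mm : (M < m)%N.
  (* As [2 < n], [q <= 2 n ^ 2 <= n ^ 3], so [q] is above the prime of index [M] and below that of
     index [m.+1]. *)
  have [q pr_q /andP[le_nq le_q]] := prime_le_double_sqr _ n_gt2.
  have [k _ def_q] := nth_prime_surj _ pr_q.
  have lt_Mk : (M < k)%N by rewrite -nth_prime_lt_mono def_q (leq_trans lt_Mn).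
  apply: leq_trans lt_Mk _; rewrite -ltnS -nth_prime_lt_mono def_q def_r.
  apply: leq_ltn_trans le_q (leq_ltn_trans _ lt_nr).
  by rewrite -mul2n [leqRHS]expnS leq_mul // ltnW.
exists (nth_prime m.+1); rewrite def_r // lt_nr /= -def_r.
rewrite -(ltr_nat R) natrX -[ltLHS]cube_root_exp3 //.
rewrite ltr_pXn2r ?nnegrE ?powR_ge0 //.
have le_root : (nth_prime m)%:R `^ 3^-1 <= n%:R :> R.
  rewrite -(@ler_pXn2r _ 3) ?nnegrE ?powR_ge0 //.
  by rewrite cube_root_exp3 // -natrX ler_nat.
(* The gap bounds the larger root by [1 - delta] plus the smaller, which is at most [n]. *)
move: (gap m lt_Mm); rewrite ltrBlDr => /lt_le_trans; apply.
by rewrite -[leRHS]natr1 [leRHS]addrC lerD // gerBl ltW.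
Qed.
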